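(* Let $R$ be a ring of the standard form below and suppose the list $[(q_1,n_1),\dots,(q_t,n_t)]$ is separating. Then the partition $\mathcal P_{\rm hom}$ induced by the normalized homogeneous weight equals the partition $\mathcal H'$. Consequently $\mathcal P_{\rm hom}$ is reflexive, and its left and right duals (which do not depend on the generating character) both equal the dual of $\mathcal H'$, namely the partition with blocks $\mathrm{rad}(R)\setminus\{0\}$, $\{0\}$, and $Q_m=\{a\in R\setminus\mathrm{rad}(R):|\{j:a_{i,j}\notin\mathrm{rad}(R_{i,j})\}|=m_i\ \forall i\}$ for $m\in\mathcal M\setminus\{0\}$ (empty sets discarded). Moreover, if $R=\mathrm{soc}(R)$ (i.e. $R$ is semisimple), then $\mathcal P_{\rm hom}$ coincides with the product of the Hamming partitions on the $R_i$ and is self-dual.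
   Context: Standard form: $R=R_1\times\cdots\times R_t$, $R_i=R_{i,1}\times\cdots\times R_{i,n_i}$, each $R_{i,j}$ a finite local Frobenius ring with $|R_{i,j}/\mathrm{rad}(R_{i,j})|=|\mathrm{soc}(R_{i,j})|=q_i$, and $q_1,\dots,q_t$ distinct ($\mathrm{rad}$ = Jacobson radical, $\mathrm{soc}$ = socle; a finite ring is Frobenius if it has a generating character $\chi$, i.e. a character of its additive group with $r\mapsto(x\mapsto\chi(xr))$ bijective onto the character group). Write $a=(a_1,\dots,a_t)$, $a_i=(a_{i,1},\dots,a_{i,n_i})$, $\mathrm{wt}(a_i)=|\{j:a_{i,j}\ne0\}|$, and $\mathcal M=\{0,\dots,n_1\}\times\cdots\times\{0,\dots,n_t\}$. $\mathcal H'$ is the partition of $R$ with blocks $R\setminus\mathrm{soc}(R)$ (if nonempty) and $P_m=\{a\in\mathrm{soc}(R):\mathrm{wt}(a_i)=m_i\ \forall i\}$, $m\in\mathcal M$. A list $[(q_1,n_1),\dots,(q_t,n_t)]$ is separating if for all $m\ne\ell$ in $\mathcal M$: $\prod_i(q_i-1)^{m_i}\ne\prod_i(q_i-1)^{\ell_i}$ or $\sum_i m_i\not\equiv\sum_i\ell_i\pmod 2$. The normalized homogeneous weight is the unique $\omega:R\to\mathbb Q$ with $\omega(0)=0$, $\omega(x)=\omega(y)$ if $Rx=Ry$, and $\sum_{y\in Rx}\omega(y)=|Rx|$ for $x\ne0$; $\mathcal P_{\rm hom}$ partitions $R$ by equal weight. For a partition $\mathcal P$ of $R$, the right $\chi$-dual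 is given by $a\sim a'$ iff $\sum_{b\in P}\chi(ab)=\sum_{b\in P}\chi(a'b)$ for all blocks $P$; left dual uses $\chi(ba)$. $\mathcal P$ is reflexive if the left $\chi$-dual of its right $\chi$-dual equals $\mathcal P$ (equivalently, $\mathcal P$ and its right dual have equally many blocks), and self-dual if it equals its right $\chi$-dual. *)

(* Defs.v *)
From HB Require Import structures.
From mathcomp Require Import all_boot all_order all_algebra all_field.
Set Implicit Arguments.
Unset Strict Implicit.
Unset Printing Implicit Defensive.
Import Order.TTheory GRing.Theory Num.Theory.
Local Open Scope ring_scope.

Section FiniteRingNotions.
Variable R : finPzRingType.

Definition is_lideal (I : {set R}) : bool :=
  [&& (0 : R) \in I,
      [forall x in I, forall y in I, x - y \in I] &
      [forall r : R, forall x in I, r * x \in I]].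

Definition maximal_lideal (I : {set R}) : bool :=
  [&& is_lideal I, I != [set: R] &
      [forall J : {set R}, (is_lideal J && (I \proper J)) ==> (J == [set: R])]].

Definition minimal_lideal (I : {set R}) : bool :=
  [&& is_lideal I, I != [set 0] &
      [forall J : {set R}, (is_lideal J && (J \proper I)) ==> (J == [set 0])]].

Definition jrad : {set R} := \bigcap_(I | maximal_lideal I) I.

(* (left) socle: sum of all minimal left ideals, i.e. the smallest left
   ideal containing all of them *)
Definition soc : {set R} :=
  \bigcap_(J | is_lideal J && [forall I, minimal_lideal I ==> (I \subset J)]) J.

Definition is_local : bool := #|[set I : {set R} | maximal_lideal I]| == 1%N.

Definition add_char (chi : R -> algC) : Prop :=
  chi 0 = 1 /\ forall x y, chi (x + y) = chi x * chi y.

Definition generating_char (chi : R -> algC) : Prop :=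
  add_char chi /\
  forall psi : R -> algC, add_char psi -> exists! r : R, forall x, psi x = chi (x * r).

Definition is_frobenius : Prop := exists chi : R -> algC, generating_char chi.

Definition lprincipal (x : R) : {set R} := [set r * x | r : R].

Definition is_norm_hom_weight (w : R -> rat) : Prop :=
  [/\ w 0 = 0,
      (forall x y, lprincipal x = lprincipal y -> w x = w y) &
      (forall x, x != 0 -> \sum_(y in lprincipal x) w y = (#|lprincipal x|)%:R)].

Definition partition_of (T : eqType) (f : R -> T) : {set {set R}} :=
  [set [set y | f y == f x] | x : R].

Definition rdual (chi : R -> algC) (P : {set {set R}}) : {set {set R}} :=
  [set [set a' | [forall B in P,
        (\sum_(b in B) chi (a' * b)) == \sum_(b in B) chi (a * b)]] | a : R].

Definition ldual (chi : R -> algC) (P : {set {set R}}) : {set {set R}} :=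
  [set [set a' | [forall B in P,
        (\sum_(b in B) chi (b * a')) == \sum_(b in B) chi (b * a)]] | a : R].

Definition reflexive_part (chi : R -> algC) (P : {set {set R}}) : Prop :=
  ldual chi (rdual chi P) = P.

Definition self_dual_part (chi : R -> algC) (P : {set {set R}}) : Prop :=
  rdual chi P = P.

End FiniteRingNotions.

Section ProdRing.
Variables (K : finType) (T : K -> finPzRingType).

Definition prodR := {dffun forall k : K, T k}.

Definition prod_zero : prodR := [ffun k => (0 : T k)].
Definition prod_opp (f : prodR) : prodR := [ffun k => - f k].
Definition prod_add (f g : prodR) : prodR := [ffun k => f k + g k].
Definition prod_one : prodR := [ffun k => (1 : T k)].
Definition prod_mul (f g : prodR) : prodR := [ffun k => f k * g k].

Fact prod_addA : associative prod_add.
Proof. by move=> f g h; apply/ffunP=> k; rewrite !ffunE addrA. Qed.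
Fact prod_addC : commutative prod_add.
Proof. by move=> f g; apply/ffunP=> k; rewrite !ffunE addrC. Qed.
Fact prod_add0 : left_id prod_zero prod_add.
Proof. by move=> f; apply/ffunP=> k; rewrite !ffunE add0r. Qed.
Fact prod_addN : left_inverse prod_zero prod_opp prod_add.
Proof. by move=> f; apply/ffunP=> k; rewrite !ffunE addNr. Qed.
Fact prod_mulA : associative prod_mul.
Proof. by move=> f g h; apply/ffunP=> k; rewrite !ffunE mulrA. Qed.
Fact prod_mul1 : left_id prod_one prod_mul.
Proof. by move=> f; apply/ffunP=> k; rewrite !ffunE mul1r. Qed.
Fact prod_mulr1 : right_id prod_one prod_mul.
Proof. by move=> f; apply/ffunP=> k; rewrite !ffunE mulr1. Qed.
Fact prod_mulDl : left_distributive prod_mul prod_add.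
Proof. by move=> f g h; apply/ffunP=> k; rewrite !ffunE mulrDl. Qed.
Fact prod_mulDr : right_distributive prod_mul prod_add.
Proof. by move=> f g h; apply/ffunP=> k; rewrite !ffunE mulrDr. Qed.

HB.instance Definition _ := Finite.on prodR.
HB.instance Definition _ := GRing.isPzRing.Build prodR
  prod_addA prod_addC prod_add0 prod_addN
  prod_mulA prod_mul1 prod_mulr1 prod_mulDl prod_mulDr.

End ProdRing.

(* Standard form: R = prod_i prod_j R_{i,j}.  The factors R_{i,j} are   *)
(* indexed by a finite type K; blk k = i says that factor k belongs to  *)
(* the i-th group, so n_i = #|{k | blk k = i}|.                         *)
Section StandardForm.
Variables (t : nat) (K : finType) (blk : K -> 'I_t) (T : K -> finPzRingType).

Local Notation R := (prodR T).

Definition nblk (i : 'I_t) : nat := #|[set k | blk k == i]|.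

Definition wt (i : 'I_t) (a : R) : nat := #|[set k | (blk k == i) && (a k != 0)]|.

Definition Mset : {set {ffun 'I_t -> 'I_(#|K|.+1)}} :=
  [set m : {ffun 'I_t -> 'I_(#|K|.+1)} | [forall i, (m i <= nblk i)%N]].

Definition Pm (m : {ffun 'I_t -> 'I_(#|K|.+1)}) : {set R} :=
  [set a in soc R | [forall i, wt i a == m i]].

Definition Hprime : {set {set R}} :=
  [set B in (~: soc R) |: [set Pm m | m in Mset] | B != set0].

Definition Qm (m : {ffun 'I_t -> 'I_(#|K|.+1)}) : {set R} :=
  [set a in ~: jrad R |
     [forall i, #|[set k | (blk k == i) && (a k \notin jrad (T k))]| == m i]].

Definition Hprime_dual : {set {set R}} :=
  [set B in [set jrad R :\ 0; [set 0]]
              :|: [set Qm m | m in [set m in Mset | [exists i, (m : {ffun 'I_t -> 'I_(#|K|.+1)}) i != 0 :> nat]]]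
     | B != set0].

Definition hamming_prod : {set {set R}} :=
  [set [set b | [forall i, wt i b == wt i a]] | a : R].

Definition separating (q : 'I_t -> nat) : bool :=
  [forall m in Mset, forall l in Mset, (m != l :> {ffun 'I_t -> 'I_(#|K|.+1)}) ==>
     ((\prod_i (q i - 1) ^ (m i) != \prod_i (q i - 1) ^ (l i))%N
      || (odd (\sum_i (m i : nat)) != odd (\sum_i (l i : nat))))].

End StandardForm.

(* Main.v *)
(** Each factor is local with simple left socle, and [soc R], [jrad R] are the
    products of the socles and radicals of the factors. Since a nonzero left
    ideal [R x] is stable under translation by the socle of any factor in which
    [x] is nonzero, the function [1 - prod_k f_k], where [f_k] is [1] at [0],
    [-1/(q_k - 1)] on the rest of the socle and [0] elsewhere, is the homogeneous
    weight. On the socle its value is [1 - (-1)^|m| / prod_i (q_i - 1)^(m_i)] for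
    the weight vector [m], and it is [1] elsewhere; the separating condition makes
    these values distinct. For the duals, the enumerator
    [sum_(b in soc R) chi (a b) X^(wt b)] factors as a product over [k] of
    [1 + (q - 1) X] or [1 - X], according to whether [a_k] lies in the radical.
    It depends only on the number of components of [a] outside the radical in
    each group, and determines these numbers. The same enumerator over [R], graded by the
    components outside the radical, gives reflexivity because [soc R] is the
    annihilator of [jrad R]. *)
Require Import Defs.
From HB Require Import structures.
From mathcomp Require Import all_boot all_order all_algebra all_field.
From mathcomp Require Import mpoly.
Set Implicit Arguments.
Unset Strict Implicit.
Unset Printing Implicit Defensive.
Import Order.TTheory GRing.Theory Num.Theory.
Local Open Scope ring_scope.

(** * Left ideals, the Jacobson radical and the left socle of a finite ring *)

Section LeftIdeals.
Variable R : finPzRingType.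
Implicit Types (a b r s x y : R) (I J : {set R}).

Lemma is_lidealP I :
  reflect [/\ 0 \in I, (forall x y, x \in I -> y \in I -> x - y \in I) &
              (forall r x, x \in I -> r * x \in I)] (is_lideal I).
Proof.
apply: (iffP and3P) => [[I0 /forall_inP IB /forallP IM] | [I0 IB IM]].
  split=> // [x y xI yI | r x xI].
    by have /forall_inP := IB x xI; apply.
  by have /forall_inP := IM r; apply.
split=> //; first by apply/forall_inP => x xI; apply/forall_inP => y yI; apply: IB.
by apply/forallP => r; apply/forall_inP => x xI; apply: IM.
Qed.

Lemma lideal0 I : is_lideal I -> 0 \in I.
Proof. by case/is_lidealP. Qed.

Lemma lidealB I x y : is_lideal I -> x \in I -> y \in I -> x - y \in I.
Proof. by case/is_lidealP => _ IB _; apply: IB. Qed.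

Lemma lidealM I r x : is_lideal I -> x \in I -> r * x \in I.
Proof. by case/is_lidealP => _ _; apply. Qed.

Lemma lidealD I x y : is_lideal I -> x \in I -> y \in I -> x + y \in I.
Proof.
move=> lI xI yI; rewrite -[y]opprK -[- y]sub0r; apply: lidealB => //.
by apply: lidealB => //; apply: lideal0.
Qed.

Lemma lideal_sum (K : finType) (F : K -> R) I :
  is_lideal I -> (forall k, F k \in I) -> \sum_k F k \in I.
Proof.
move=> lI FI; elim/big_ind: _ => [|x y xI yI|k _ //]; first exact: lideal0.
exact: lidealD.
Qed.

Lemma lideal_setT I : is_lideal I -> 1 \in I -> I = [set: R].
Proof.
move=> lI I1; apply/setP => x; rewrite inE -[x]mulr1.
exact: lidealM.
Qed.

Lemma lprincipalP x y : reflect (exists r, y = r * x) (y \in lprincipal x).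
Proof. by apply: (iffP imsetP) => [[r _ ->]|[r ->]]; exists r. Qed.

Lemma lprincipal_refl x : x \in lprincipal x.
Proof. by apply/lprincipalP; exists 1; rewrite mul1r. Qed.

Lemma lprincipal_lideal x : is_lideal (lprincipal x).
Proof.
apply/is_lidealP; split.
- by apply/lprincipalP; exists 0; rewrite mul0r.
- move=> _ _ /lprincipalP[r ->] /lprincipalP[s ->].
  by apply/lprincipalP; exists (r - s); rewrite mulrBl.
- by move=> r _ /lprincipalP[s ->]; apply/lprincipalP; exists (r * s); rewrite mulrA.
Qed.

Lemma lprincipal_sub I x : is_lideal I -> x \in I -> lprincipal x \subset I.
Proof. by move=> lI xI; apply/subsetP => _ /lprincipalP[r ->]; apply: lidealM. Qed.

Lemma sub_maximal_lideal I : is_lideal I -> I != [set: R] ->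
  exists2 M, maximal_lideal M & I \subset M.
Proof.
move=> lI In1.
have PI : is_lideal I && (I != [set: R]) by rewrite lI.
have [M /maxsetP[/andP[lM Mn1] maxM] sIM] :=
  maxset_exists (P := fun J => is_lideal J && (J != [set: R])) PI.
exists M => //; rewrite /maximal_lideal lM Mn1; apply/forallP => J.
apply/implyP => /andP[lJ /properP[sMJ [x xJ xM]]]; apply: contraNT xM => Jn1.
by rewrite -(maxM J) ?lJ.
Qed.

Lemma minimal_lideal_sub I : is_lideal I -> I != [set 0] ->
  exists2 M, minimal_lideal M & M \subset I.
Proof.
move=> lI In0.
have PI : is_lideal I && (I != [set 0]) by rewrite lI.
have [M /minsetP[/andP[lM Mn0] minM] sMI] :=
  minset_exists (P := fun J => is_lideal J && (J != [set 0])) PI.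
exists M => //; rewrite /minimal_lideal lM Mn0; apply/forallP => J.
apply/implyP => /andP[lJ /properP[sJM [x xM xJ]]]; apply: contraNT xJ => Jn0.
by rewrite (minM J) ?lJ.
Qed.

(** If [1 - r * a] had no left inverse, a maximal left ideal would contain it together with [r * a],
    hence [1]. This elementwise form is what makes the radical computable in products. *)
Lemma jradP a :
  reflect (forall r, exists s, s * (1 - r * a) = 1) (a \in jrad R).
Proof.
apply: (iffP bigcapP) => [aJ r | inva M /and3P[lM Mn1 /forallP maxM]].
  have [L1|] := eqVneq (lprincipal (1 - r * a)) [set: R].
    have: 1 \in lprincipal (1 - r * a) by rewrite L1 inE.
    by case/lprincipalP => s s1; exists s.
  case/(sub_maximal_lideal (lprincipal_lideal _)) => M maxM sM.
  have [lM Mn1 _] := and3P maxM; case/eqP: Mn1; apply: lideal_setT => //.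
  rewrite -[1](subrK (r * a)); apply: lidealD => //.
    exact: (subsetP sM) (lprincipal_refl _).
  by apply: lidealM => //; apply: aJ.
apply/negPn/negP => aM.
(* [N] is the left ideal [M + R a], strictly larger than [M]. Maximality then puts some [1 - r * a]
   in [M], although it is left invertible. *)
pose N := [set x | [exists r, x - r * a \in M]].
have lN : is_lideal N.
  apply/is_lidealP; split.
  - by rewrite inE; apply/existsP; exists 0; rewrite mul0r subr0 lideal0.
  - move=> x y; rewrite !inE => /existsP[r xr] /existsP[s ys].
    apply/existsP; exists (r - s).
    have -> : x - y - (r - s) * a = (x - r * a) - (y - s * a).
      by rewrite mulrBl !opprD addrACA.
    exact: lidealB.
  - move=> r x; rewrite !inE => /existsP[s xs]; apply/existsP; exists (r * s).
    by rewrite -mulrA -mulrBr; apply: lidealM.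
have /implyP := maxM N; rewrite lN /=.
have sMN : M \subset N.
  by apply/subsetP => x xM; rewrite inE; apply/existsP; exists 0; rewrite mul0r subr0.
have aN : a \in N.
  by rewrite inE; apply/existsP; exists 1; rewrite mul1r subrr lideal0.
have -> : M \proper N by apply/properP; split=> //; exists a.
move=> /(_ isT)/eqP N1; have: 1 \in N by rewrite N1 inE.
rewrite inE => /existsP[r rM]; have [s s1] := inva r.
by case/eqP: Mn1; apply: lideal_setT => //; rewrite -s1; apply: lidealM.
Qed.

Lemma jrad_lideal : is_lideal (jrad R).
Proof.
apply/is_lidealP; split.
- by apply/bigcapP => M /and3P[lM _ _]; apply: lideal0.
- move=> x y /bigcapP xJ /bigcapP yJ; apply/bigcapP => M maxM.
  by case/and3P: (maxM) => lM _ _; apply: lidealB => //; [apply: xJ|apply: yJ].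
- move=> r x /bigcapP xJ; apply/bigcapP => M maxM.
  by case/and3P: (maxM) => lM _ _; apply: lidealM => //; apply: xJ.
Qed.

Lemma soc_lideal : is_lideal (soc R).
Proof.
apply/is_lidealP; split.
- by apply/bigcapP => M /andP[lM _]; apply: lideal0.
- move=> x y /bigcapP xJ /bigcapP yJ; apply/bigcapP => M HM.
  by case/andP: (HM) => lM _; apply: lidealB => //; [apply: xJ|apply: yJ].
- move=> r x /bigcapP xJ; apply/bigcapP => M HM.
  by case/andP: (HM) => lM _; apply: lidealM => //; apply: xJ.
Qed.

Lemma minimal_lideal_soc I : minimal_lideal I -> I \subset soc R.
Proof.
move=> mI; apply/subsetP => x xI; apply/bigcapP => J /andP[_ /forallP/(_ I)].
by rewrite mI => /subsetP; apply.
Qed.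

Lemma jrad_mulr a r : a \in jrad R -> a * r \in jrad R.
Proof.
move=> /jradP inva; apply/jradP => s; have [t t1] := inva (r * s).
(* A left inverse [t] of [1 - r s a] yields the left inverse [1 + s a t r] of [1 - s a r]. *)
exists (1 + s * a * t * r); rewrite mulrDl mul1r.
have -> : s * a * t * r * (1 - s * (a * r)) = s * (a * r).
  rewrite -!mulrA mulrBr mulr1.
  have -> : r - r * (s * (a * r)) = (1 - r * s * a) * r.
    by rewrite mulrBl mul1r -!mulrA.
  by rewrite [t * _]mulrA t1 mul1r.
by rewrite subrK.
Qed.

(** The elements killed by the radical form a left ideal, and by a Nakayama argument it contains
    every minimal left ideal, hence the socle. *)
Lemma soc_jrad_ann x j : x \in soc R -> j \in jrad R -> j * x = 0.
Proof.
move=> xS; pose B := [set x | [forall j in jrad R, j * x == 0]].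
suff : x \in B by rewrite !inE => /forall_inP xB jJ; apply/eqP/xB.
move/bigcapP: xS; apply; apply/andP; split.
  apply/is_lidealP; split.
  - by rewrite inE; apply/forall_inP => i _; rewrite mulr0.
  - move=> y z; rewrite !inE => /forall_inP y0 /forall_inP z0.
    apply/forall_inP => i iJ.
    by rewrite mulrBr (eqP (y0 i iJ)) (eqP (z0 i iJ)) subrr.
  - move=> r y; rewrite !inE => /forall_inP y0; apply/forall_inP => i iJ.
    by rewrite mulrA y0 // jrad_mulr.
apply/forallP => I; apply/implyP => /and3P[lI _ /forallP minI].
apply/subsetP => y yI; rewrite inE; apply/forall_inP => i iJ.
apply/negPn/negP => iy0.
have sub : lprincipal (i * y) \subset I by rewrite lprincipal_sub ?lidealM.
have : y \in lprincipal (i * y).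
  apply: contraR iy0 => yL; have /implyP := minI (lprincipal (i * y)).
  rewrite lprincipal_lideal properE sub /=.
  have -> : ~~ (I \subset lprincipal (i * y)) by apply: contraNN yL => /subsetP->.
  move=> /(_ isT)/eqP L0; move: (lprincipal_refl (i * y)).
  by rewrite L0 inE.
(* Here [y = r * (i * y)], so [(1 - r * i) * y = 0] with a left invertible factor, which forces
   [y = 0]. *)
case/lprincipalP => r yr; have /jradP/(_ r)[s s1] := iJ.
case/eqP: iy0; suff -> : y = 0 by rewrite mulr0.
by rewrite -[y]mul1r -s1 -mulrA mulrBl mul1r -mulrA -yr subrr mulr0.
Qed.

(** The hypothesis says that every nonzero multiple of [x] generates [x] again, so [R x] is zero or
    minimal. *)
Lemma in_soc x : (forall r, r * x = 0 \/ exists s, s * (r * x) = x) -> x \in soc R.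
Proof.
have [-> _|x0 Hx] := eqVneq x 0; first exact: lideal0 soc_lideal.
apply: (subsetP (minimal_lideal_soc (I := lprincipal x) _)); last exact: lprincipal_refl.
apply/and3P; split; first exact: lprincipal_lideal.
  by apply: contraNneq x0 => L0; rewrite -in_set1 -L0 lprincipal_refl.
apply/forallP => I; apply/implyP => /andP[lI /properP[sI [y /lprincipalP[r yr] yI]]].
rewrite eqEsubset sub1set lideal0 // andbT.
apply/subsetP => z zI; rewrite inE.
have /lprincipalP[s zs] := subsetP sI z zI.
case: (Hx s) => [<-|[u us]]; first by rewrite zs.
by case/negP: yI; rewrite yr -us -zs !lidealM.
Qed.

Lemma lideal_meets_soc I : is_lideal I -> I != [set 0] ->
  exists x, [/\ x \in I, x \in soc R & x != 0].
Proof.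
move=> lI In0; have [M mM sMI] := minimal_lideal_sub lI In0.
have [lM Mn0 _] := and3P mM.
have /subsetPn[x xM] : ~~ (M \subset [set 0]).
  by apply: contraNN Mn0 => s0; rewrite eqEsubset s0 sub1set lideal0.
rewrite inE => x0; exists x; split=> //; first exact: (subsetP sMI).
exact: (subsetP (minimal_lideal_soc mM)).
Qed.

End LeftIdeals.

(** * Finite local rings: units, socle, and annihilators between radical and socle *)

Section LocalRing.
Variable A : finPzRingType.
Hypothesis locA : is_local A.
Implicit Types (a b r s x y : A).

Lemma local_jrad_maximal : maximal_lideal (jrad A).
Proof.
have /eqP/eqP/cards1P[M defM] := locA.
have maxE I : maximal_lideal I = (I == M).
  by have := in_set1 I M; rewrite -defM inE.
by rewrite /jrad (eq_bigl _ _ maxE) big_pred1_eq maxE.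
Qed.

Lemma local_jrad1 : 1 \notin jrad A.
Proof.
have /and3P[lJ Jn1 _] := local_jrad_maximal.
by apply: contraNN Jn1 => J1; apply/eqP/lideal_setT.
Qed.

Lemma local_jrad_proper : jrad A \proper [set: A].
Proof. by rewrite properT; case/and3P: local_jrad_maximal. Qed.

(** Proper left ideals lie in the only maximal one, so elements outside the radical have left
    inverses. Such an inverse is itself outside the radical, which absorbs right multiplication, so
    it has a left inverse too, necessarily [a]. *)
Lemma local_unit a : a \notin jrad A -> exists s, s * a = 1 /\ a * s = 1.
Proof.
move=> aJ.
have linv b : b \notin jrad A -> exists s, s * b = 1.
  move=> bJ; suff /lprincipalP[s s1] : 1 \in lprincipal b by exists s.
  have [->|/(sub_maximal_lideal (lprincipal_lideal _))[M maxM sM]] :=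
    eqVneq (lprincipal b) [set: A]; first by rewrite inE.
  case/negP: bJ; suff -> : jrad A = M by apply: (subsetP sM); apply: lprincipal_refl.
  have /eqP/eqP/cards1P[N defN] := locA.
  have := local_jrad_maximal; rewrite -[maximal_lideal _]in_set defN inE => /eqP->.
  by move: maxM; rewrite -[maximal_lideal _]in_set defN inE => /eqP->.
have [s s1] := linv a aJ; exists s; split=> //.
have sJ : s \notin jrad A.
  by apply: contraNN local_jrad1 => sJ; rewrite -s1 jrad_mulr.
have [u u1] := linv s sJ; suff <- : u = a by [].
by rewrite -[u]mulr1 -s1 mulrA u1 mul1r.
Qed.

(** A multiplier in the radical kills such an [x], and any other multiplier is a unit and can be
    undone, so [in_soc] applies. Stability of the left socle under right multiplication follows. *)
Lemma local_soc x : (x \in soc A) = [forall j in jrad A, j * x == 0].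
Proof.
apply/idP/forall_inP => [xS j jJ|xJ]; first by rewrite soc_jrad_ann.
apply: in_soc => r; have [rJ|rJ] := boolP (r \in jrad A).
  by left; apply/eqP/xJ.
by right; have [s [s1 _]] := local_unit rJ; exists s; rewrite mulrA s1 mul1r.
Qed.

Lemma local_soc_mulr x r : x \in soc A -> x * r \in soc A.
Proof.
rewrite !local_soc => /forall_inP xJ; apply/forall_inP => j jJ.
by rewrite mulrA (eqP (xJ j jJ)) mul0r.
Qed.

(** By finiteness two powers [a ^+ i] and [a ^+ j] agree with [i < j], and [1 - a ^+ (j - i)] is
    left invertible. *)
Lemma jrad_nilpotent a : a \in jrad A -> exists n, a ^+ n = 0.
Proof.
move=> aJ; pose f (i : 'I_#|A|.+1) := a ^+ i.
have /injectivePn[i [j ij fij]] : ~~ injectiveb f.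
  by apply/negP => /injectiveP/leq_card; rewrite card_ord ltnn.
wlog lt_ij : i j ij fij / (i < j)%N.
  move=> th; have : (i < j)%N || (j < i)%N by rewrite -neq_ltn.
  by case/orP => [|/th]; [apply: th|apply; rewrite // eq_sym].
exists i; have aijJ : a ^+ (j - i) \in jrad A.
  by rewrite -(ltn_predK (_ : 0 < j - i)%N) ?subn_gt0 // exprS jrad_mulr.
have /jradP/(_ 1)[s s1] := aijJ; move: s1; rewrite mul1r => s1.
rewrite -[a ^+ i]mul1r -s1 -mulrA mulrBl mul1r -exprD subnK ?(ltnW lt_ij) //.
by rewrite -[a ^+ j]/(f j) -fij subrr mulr0.
Qed.

Variable q : nat.
Hypothesis resA : #|A| = (q * #|jrad A|)%N.
Hypothesis socA : #|soc A| = q.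

Lemma local_q_gt1 : (1 < q)%N.
Proof.
have := proper_card local_jrad_proper; rewrite cardsT resA.
rewrite -[X in (X < _)%N]mul1n ltn_mul2r; case/andP=> //.
Qed.

Lemma local_soc_neq0 : soc A != [set 0].
Proof. by apply: contraTneq local_q_gt1 => S0; rewrite -socA S0 cards1. Qed.

(* The annihilator of a nonzero element of the socle is the radical, hence its
   orbit under left multiplication has [q] elements and exhausts the socle. *)
Lemma local_soc_simple x : x \in soc A -> x != 0 -> lprincipal x = soc A.
Proof.
move=> xS x0; apply/eqP; rewrite eqEcard lprincipal_sub ?soc_lideal //= socA.
have J_gt0 : (0 < #|jrad A|)%N.
  by apply/card_gt0P; exists 0; apply: lideal0 (jrad_lideal _).
rewrite -(leq_pmul2r J_gt0) -resA -[X in (X <= _)%N]sum1_card.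
rewrite (partition_big (fun r => r * x) (mem (lprincipal x))) /=; last first.
  by move=> r _; apply/lprincipalP; exists r.
rewrite -sum_nat_const; apply: leq_sum => _ /lprincipalP[r ->].
rewrite sum1_card -(card_imset (mem (jrad A)) (addrI r)); apply: subset_leq_card.
apply/subsetP => s; rewrite unfold_in => /eqP sx.
apply/imsetP; exists (s - r); last by rewrite addrC subrK.
apply/negPn/negP => /local_unit[u [u1 _]]; case/eqP: x0.
by rewrite -[x]mul1r -u1 -mulrA mulrBl sx subrr mulr0.
Qed.

(** A nonzero left ideal meets the socle in a nonzero element, and that element already generates
    the whole socle. *)
Lemma local_soc_sub_lideal (I : {set A}) :
  is_lideal I -> I != [set 0] -> soc A \subset I.
Proof.
move=> lI /(lideal_meets_soc lI)[x [xI xS x0]].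
by rewrite -(local_soc_simple xS x0) lprincipal_sub.
Qed.

(** If [x * j] were nonzero it would generate the socle, so [x = r * x * j]. Iterating gives
    [x = r ^+ m * x * j ^+ m] for all [m], which contradicts nilpotency of [j]. *)
Lemma local_soc_mul_jrad x j : x \in soc A -> j \in jrad A -> x * j = 0.
Proof.
move=> xS jJ; apply/eqP; apply: contraT => xj0.
have : x \in lprincipal (x * j) by rewrite local_soc_simple ?local_soc_mulr.
case/lprincipalP => r xr; have [n jn0] := jrad_nilpotent jJ.
suff xE m : x = r ^+ m * x * j ^+ m by case/eqP: xj0; rewrite (xE n) jn0 mulr0 mul0r.
elim: m => [|m IH]; first by rewrite mul1r mulr1.
by rewrite {1}IH {1}xr exprSr exprS !mulrA.
Qed.

(** An element outside the radical is a unit and cannot kill a nonzero element of the socle. With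
    its mirror image [local_jrad_annl], this evaluates the character sums over the socle. *)
Lemma local_jrad_annr x : (x \in jrad A) = [forall s in soc A, x * s == 0].
Proof.
apply/idP/forall_inP => [xJ s sS|xS]; first by rewrite soc_jrad_ann.
apply/negPn/negP => /local_unit[u [u1 _]].
have [y [_ yS y0]] := lideal_meets_soc (soc_lideal A) local_soc_neq0.
by case/eqP: y0; rewrite -[y]mul1r -u1 -mulrA (eqP (xS y yS)) mulr0.
Qed.

Lemma local_jrad_annl x : (x \in jrad A) = [forall s in soc A, s * x == 0].
Proof.
apply/idP/forall_inP => [xJ s sS|xS]; first by rewrite local_soc_mul_jrad.
apply/negPn/negP => /local_unit[u [_ u1]].
have [y [_ yS y0]] := lideal_meets_soc (soc_lideal A) local_soc_neq0.
by case/eqP: y0; rewrite -[y]mulr1 -u1 mulrA (eqP (xS y yS)) mul0r.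
Qed.

End LocalRing.

(** * Uniqueness of the homogeneous weight, and the local coweight *)

Section HomWeight.
Variable R : finPzRingType.
Implicit Types (x y : R) (w : R -> rat).

(** Induction on the size of [R x]: an element of [R x] either generates it, and then has the same
    difference of weights as [x], or generates a smaller ideal, where the weights already agree. *)
Lemma norm_hom_weight_unique w w' :
  is_norm_hom_weight w -> is_norm_hom_weight w' -> w =1 w'.
Proof.
move=> [w0 wE wS] [w'0 w'E w'S] x.
have [n] := ubnP #|lprincipal x|; elim: n x => // n IH x; rewrite ltnS => le_xn.
have [->|x0] := eqVneq x 0; first by rewrite w0 w'0.
apply/eqP; rewrite -subr_eq0.
have : \sum_(y in lprincipal x) (w y - w' y) = 0.
  by rewrite sumrB wS // w'S // subrr.
rewrite (bigID (fun y => lprincipal y == lprincipal x)) /=.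
rewrite [X in _ + X]big1 ?addr0; last first.
  move=> y /andP[yx nyx]; rewrite IH ?subrr //; apply: leq_trans le_xn.
  by apply: proper_card; rewrite properEneq nyx lprincipal_sub ?lprincipal_lideal.
rewrite (eq_bigr (fun=> w x - w' x)); last first.
  by move=> y /andP[_ /eqP xy]; rewrite (wE _ _ xy) (w'E _ _ xy).
rewrite sumr_const => /eqP; rewrite mulrn_eq0 => /orP[|//].
by rewrite -leqn0 leqNgt => /negP[]; apply/card_gt0P; exists x;
  rewrite unfold_in lprincipal_refl eqxx.
Qed.

(* One minus the normalized homogeneous weight of a local ring with residue
   field of order [q]. *)
Definition soc_coweight (q : nat) x : rat :=
  if x == 0 then 1 else if x \in soc R then - (q%:R - 1)^-1 else 0.

(** For [x] off the socle the coset [x + soc R] avoids the socle and all terms vanish. For [x] in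
    the socle the coset is the socle itself, and the sum is [1 - (q - 1) / (q - 1)]. *)
Lemma sum_soc_coweight q x : is_local R ->
    #|R| = (q * #|jrad R|)%N -> #|soc R| = q ->
  \sum_(s in soc R) soc_coweight q (x + s) = 0.
Proof.
move=> locR resR socR; have lS := soc_lideal R; have S0 := lideal0 lS.
have [xS|xS] := boolP (x \in soc R); last first.
  rewrite big1 // => s sS; rewrite /soc_coweight.
  have xsS : x + s \notin soc R.
    by apply: contraNN xS => xsS; rewrite -[x](addrK s) lidealB.
  by rewrite (negPf xsS) ifF //; apply: contraNF xsS => /eqP->.
rewrite (reindex_inj (addrI (- x))) /=.
have xE s : (- x + s \in soc R) = (s \in soc R).
  apply/idP/idP => [sS|sS]; last by rewrite addrC lidealB.
  by rewrite -[s](addKr (- x)) opprK lidealD.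
under eq_bigl do rewrite xE.
under eq_bigr do rewrite addrA subrr add0r.
rewrite (bigD1 0) //= {1}/soc_coweight eqxx.
rewrite (eq_bigr (fun=> - (q%:R - 1)^-1)); last first.
  by move=> s /andP[sS s0]; rewrite /soc_coweight (negPf s0) sS.
rewrite sumr_const.
have -> : #|[pred i in soc R | i != 0]| = q.-1.
  rewrite -socR (cardsD1 0) S0 /=; apply: eq_card => s.
  by rewrite !inE andbC.
have q1 := local_q_gt1 locR resR.
have -> : q%:R - 1 = q.-1%:R :> rat by rewrite -subn1 natrB // ltnW.
by rewrite -[- _ *+ _]mulr_natr mulNr mulVf ?subrr // pnatr_eq0; case: (q) q1 => [|[]].
Qed.

End HomWeight.

(** * Radical, socle and homogeneous weight of a product ring *)

Section ProductRing.
Variables (K : finType) (T : K -> finPzRingType).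
Local Notation R := (prodR T).
Implicit Types (a b r s : R).

Lemma prodDE a b k : (a + b) k = a k + b k.
Proof. exact: ffunE. Qed.
Lemma prodME a b k : (a * b) k = a k * b k.
Proof. exact: ffunE. Qed.
Lemma prodNE a k : (- a) k = - a k.
Proof. exact: ffunE. Qed.
Lemma prod0E k : (0 : R) k = 0.
Proof. exact: ffunE. Qed.
Lemma prod1E k : (1 : R) k = 1.
Proof. exact: ffunE. Qed.

Lemma prod_sumE (I : finType) (F : I -> R) k : (\sum_i F i) k = \sum_i F i k.
Proof. by apply: (big_morph (fun a : R => a k)) => [a b|]; rewrite ?prodDE ?prod0E. Qed.

Definition pinj k (x : T k) : R := [ffun j => dfwith (fun i => 0 : T i) x j].

Lemma pinj_in k (x : T k) : pinj x k = x.
Proof. by rewrite ffunE dfwith_in. Qed.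

Lemma pinj_out k j (x : T k) : k != j -> pinj x j = 0.
Proof. by move=> kj; rewrite ffunE dfwith_out. Qed.

Lemma pinj0 k : pinj (0 : T k) = 0.
Proof.
apply/ffunP => j; rewrite prod0E.
by have [<-|kj] := eqVneq k j; rewrite ?pinj_in ?pinj_out.
Qed.

Lemma pinjD k (x y : T k) : pinj (x + y) = pinj x + pinj y.
Proof.
apply/ffunP => j; rewrite prodDE.
by have [<-|kj] := eqVneq k j; rewrite ?pinj_in ?pinj_out ?addr0.
Qed.

Lemma mul_pinj a k (x : T k) : a * pinj x = pinj (a k * x).
Proof.
apply/ffunP => j; rewrite prodME.
by have [<-|kj] := eqVneq k j; rewrite ?pinj_in ?pinj_out ?mulr0.
Qed.

Lemma pinj_mul a k (x : T k) : pinj x * a = pinj (x * a k).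
Proof.
apply/ffunP => j; rewrite prodME.
by have [<-|kj] := eqVneq k j; rewrite ?pinj_in ?pinj_out ?mul0r.
Qed.

Lemma sum_pinj a : \sum_k pinj (a k) = a.
Proof.
apply/ffunP => k; rewrite prod_sumE (bigD1 k) //= pinj_in big1 ?addr0 // => j jk.
by rewrite pinj_out.
Qed.

Lemma jrad_prod a : (a \in jrad R) = [forall k, a k \in jrad (T k)].
Proof.
apply/jradP/forallP => [inva k|aJ r].
  apply/jradP => r; have [s s1] := inva (pinj r); exists (s k).
  have := congr1 (fun b : R => b k) s1.
  by rewrite /= prodME prodDE prodNE prodME pinj_in prod1E.
have /fin_all_exists[s s1] k : exists u : T k, u * (1 - r k * a k) = 1.
  by have /jradP := aJ k; apply.
exists [ffun k => s k]; apply/ffunP => k.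
by rewrite prodME prodDE prodNE prodME prod1E ffunE; apply: s1.
Qed.

Lemma pinj_jrad k (x : T k) : x \in jrad (T k) -> pinj x \in jrad R.
Proof.
move=> xJ; rewrite jrad_prod; apply/forallP => j.
by have [<-|kj] := eqVneq k j; rewrite ?pinj_in ?pinj_out ?lideal0 ?jrad_lideal.
Qed.

(** Radical elements supported on one factor kill the socle of the product, which places each
    component in its local socle. Conversely, [a] is the sum of its one-factor parts, and each
    multiplier either kills such a part or can be undone on it. *)
Lemma soc_prod a : (forall k, is_local (T k)) ->
  (a \in soc R) = [forall k, a k \in soc (T k)].
Proof.
move=> locT; apply/idP/forallP => [aS k|aS].
  rewrite local_soc //; apply/forall_inP => j jJ.
  have := soc_jrad_ann aS (pinj_jrad jJ); rewrite pinj_mul => /(congr1 (fun b : R => b k)).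
  by rewrite /= pinj_in prod0E => ->.
rewrite -[a]sum_pinj; apply: lideal_sum (soc_lideal _) _ => k.
apply: in_soc => r; rewrite mul_pinj.
have [rJ|rJ] := boolP (r k \in jrad (T k)).
  by left; rewrite soc_jrad_ann ?pinj0.
right; have [s [s1 _]] := local_unit (locT k) rJ; exists (pinj s).
by rewrite pinj_mul pinj_in mulrA s1 mul1r.
Qed.

Definition prod_coweight (q : K -> nat) a : rat := \prod_k soc_coweight (q k) (a k).

Hypothesis locT : forall k, is_local (T k).
Variable q : K -> nat.
Hypothesis resT : forall k, #|T k| = (q k * #|jrad (T k)|)%N.
Hypothesis socT : forall k, #|soc (T k)| = q k.

Lemma prod_coweight_notin_soc a : a \notin soc R -> prod_coweight q a = 0.
Proof.
rewrite soc_prod // negb_forall => /existsP[k ak]; apply/eqP/prodf_eq0; exists k => //.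
rewrite /soc_coweight (negPf ak) ifF //; apply: contraNF ak => /eqP->.
by rewrite lideal0 ?soc_lideal.
Qed.

(* [lprincipal x] is invariant under translation by the socle of a factor where
   [x] does not vanish, and the coweight sums to zero over each translate. *)
Lemma sum_prod_coweight x : x != 0 ->
  \sum_(y in lprincipal x) prod_coweight q y = 0.
Proof.
move=> x0; have [k xk0] : exists k, x k != 0.
  apply/existsP; apply: contraR x0; rewrite negb_exists => /forallP x0.
  by apply/eqP/ffunP => k; rewrite prod0E; apply/eqP; rewrite -[_ == _]negbK.
have lx := lprincipal_lideal x.
have sub (s : T k) : s \in soc (T k) -> pinj s \in lprincipal x.
  have xk1 : lprincipal (x k) != [set 0].
    by apply: contraNneq xk0 => L0; rewrite -in_set1 -L0 lprincipal_refl.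
  have /subsetP sS := local_soc_sub_lideal (locT k) (resT k) (socT k)
     (lprincipal_lideal (x k)) xk1.
  move=> /sS/lprincipalP[r ->].
  by apply/lprincipalP; exists (pinj r); rewrite pinj_mul.
have q0 : (#|soc (T k)|)%:R != 0 :> rat.
  by rewrite socT pnatr_eq0 -lt0n ltnW // (local_q_gt1 (locT k) (resT k)).
apply: (mulfI q0); rewrite mulr0 mulr_natl -sumr_const.
transitivity (\sum_(s in soc (T k)) \sum_(y in lprincipal x) prod_coweight q (y + pinj s)).
  apply: eq_bigr => s /sub sx; rewrite (reindex_inj (addIr (pinj s))) /=.
  apply: eq_bigl => y; apply/idP/idP => [ysx|yx]; last exact: lidealD.
  by rewrite -[y](addrK (pinj s)) lidealB.
rewrite exchange_big big1 // => y _.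
transitivity (\sum_(s in soc (T k)) soc_coweight (q k) (y k + s)
              * \prod_(j | j != k) soc_coweight (q j) (y j)).
  apply: eq_bigr => s _; rewrite /prod_coweight (bigD1 k) //= prodDE pinj_in.
  congr (_ * _); apply: eq_bigr => j jk.
  by rewrite prodDE pinj_out ?addr0 // eq_sym.
by rewrite -mulr_suml sum_soc_coweight // mul0r.
Qed.

Lemma prod_norm_hom_weight : is_norm_hom_weight (fun a => 1 - prod_coweight q a).
Proof.
split=> [|x y xy|x x0].
- rewrite /prod_coweight big1 ?subrr // => k _.
  by rewrite /soc_coweight prod0E eqxx.
- congr (1 - _); apply: eq_bigr => k _.
  have /lprincipalP[r xr] : x \in lprincipal y by rewrite -xy lprincipal_refl.
  have /lprincipalP[s ys] : y \in lprincipal x by rewrite xy lprincipal_refl.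
  have {}xr : x k = r k * y k by rewrite -prodME -xr.
  have {}ys : y k = s k * x k by rewrite -prodME -ys.
  have lS := soc_lideal (T k).
  rewrite /soc_coweight.
  have -> : (x k == 0) = (y k == 0).
    by apply/eqP/eqP => e; [rewrite ys e mulr0|rewrite xr e mulr0].
  suff -> : (x k \in soc (T k)) = (y k \in soc (T k)) by [].
  by apply/idP/idP => e; [rewrite ys|rewrite xr]; apply: lidealM.
- by rewrite sumrB sum_prod_coweight // subr0 sumr_const.
Qed.

End ProductRing.

(** * Partitions as level sets of a labelling function *)

Section PartitionOf.
Variable R : finPzRingType.

(** Reduces a family of sets with empty members discarded to a labelling: each nonempty member is
    the full level set of any of its points. *)
Lemma partition_of_blocks (V : eqType) (f : R -> V) (C : {set {set R}}) :
    (forall B x y, B \in C -> x \in B -> (y \in B) = (f y == f x)) ->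
    (forall x, exists2 B, B \in C & x \in B) ->
  [set B in C | B != set0] = partition_of f.
Proof.
move=> fC cover; apply/setP => B; rewrite inE; apply/andP/imsetP => [[BC B0]|[x _ ->]].
  have [x xB] := set0Pn _ B0; exists x => //; apply/setP => y.
  by rewrite inE (fC B x).
have [B' B'C xB'] := cover x.
have -> : [set y | f y == f x] = B' by apply/setP => y; rewrite inE (fC B' x).
by split=> //; apply/set0Pn; exists x.
Qed.

Lemma eq_partition_of (V V' : eqType) (f : R -> V) (f' : R -> V') :
  (forall x y, (f y == f x) = (f' y == f' x)) -> partition_of f = partition_of f'.
Proof.
by move=> ff'; apply: eq_imset => x; apply/setP => y; rewrite !inE.
Qed.

End PartitionOf.

(** * Count vectors by group, and the separating condition *)

Section Counting.
Variables (t : nat) (K : finType) (blk : K -> 'I_t).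

Definition blk_count (c : pred K) : {ffun 'I_t -> nat} :=
  [ffun i => #|[set k | (blk k == i) && c k]|].

Lemma blk_count_le c i : (blk_count c i <= nblk blk i)%N.
Proof.
by rewrite ffunE subset_leq_card //; apply/subsetP => k; rewrite !inE => /andP[].
Qed.

Lemma blk_count_ltK c i : (blk_count c i < #|K|.+1)%N.
Proof. by rewrite ltnS (leq_trans (blk_count_le c i)) // max_card. Qed.

Lemma blk_count_gt0 c i : (0 < blk_count c i)%N = [exists k, (blk k == i) && c k].
Proof.
rewrite ffunE; apply/card_gt0P/existsP => -[k ck]; exists k; first by rewrite inE in ck.
by rewrite inE.
Qed.

Lemma prod_blk_count (C : comPzRingType) (F : 'I_t -> C) (c : pred K) :
  \prod_(k | c k) F (blk k) = \prod_i F i ^+ blk_count c i.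
Proof.
rewrite (partition_big blk predT) //=; apply: eq_bigr => i _.
rewrite (eq_bigr (fun=> F i)); last by move=> k /andP[_ /eqP->].
by rewrite prodr_const ffunE; congr (_ ^+ _); apply: eq_card => k; rewrite !inE andbC.
Qed.

(** The count vector in the index type of [Mset]. The value of [inord] is exact, since no count
    exceeds [#|K|]. *)
Definition count_index (c : pred K) : {ffun 'I_t -> 'I_(#|K|.+1)} :=
  [ffun i => inord (blk_count c i)].

Lemma count_indexE c i : count_index c i = blk_count c i :> nat.
Proof. by rewrite ffunE inordK ?blk_count_ltK. Qed.

Lemma count_index_Mset c : count_index c \in Mset blk.
Proof. by rewrite inE; apply/forallP => i; rewrite count_indexE blk_count_le. Qed.

(** The absolute value of the product gives [prod_i (q_i - 1)^(m_i)] and its sign gives the parity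
    of the total count, the two quantities compared by [separating]. *)
Lemma separating_blk_count (q : 'I_t -> nat) c c' : separating blk q ->
    (forall k, (1 < q (blk k))%N) ->
    \prod_(k | c k) - ((q (blk k))%:R - 1)^-1 =
      \prod_(k | c' k) - ((q (blk k))%:R - 1)^-1 :> rat ->
  blk_count c = blk_count c'.
Proof.
move=> sep q1.
pose N d := (\prod_i (q i - 1) ^ (count_index d i))%N.
(* For an empty group [q i - 1] may be zero, but then its exponent is zero as well. *)
have N_gt0 d : (0 < N d)%N.
  apply/prodn_gt0 => i; rewrite expn_gt0 subn_gt0.
  have [_|] := posnP (count_index d i); first by rewrite orbT.
  by rewrite count_indexE blk_count_gt0 => /existsP[k /andP[/eqP <- _]]; rewrite q1.
have valE d : \prod_(k | d k) - ((q (blk k))%:R - 1)^-1 =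
    (-1) ^+ (\sum_i (count_index d i : nat)) / (N d)%:R :> rat.
  pose F i : rat := - ((q i - 1)%N%:R)^-1.
  rewrite (eq_bigr (fun k => F (blk k))); last first.
    by move=> k _; rewrite /F natrB // ltnW.
  rewrite prod_blk_count expr_sum /N natr_prod -prodfV -big_split.
  apply: eq_bigr => i _; rewrite -count_indexE natrX -exprVn.
  by rewrite /F [LHS]exprNn.
rewrite !valE => eq_val.
have eqN : N c = N c'.
  have := congr1 Num.norm eq_val; rewrite !normrM !normrX !normrN1 !expr1n !mul1r.
  rewrite !normfV !normr_nat => /invr_inj/eqP.
  by rewrite eqr_nat => /eqP.
have eqs : odd (\sum_i (count_index c i : nat)) = odd (\sum_i (count_index c' i : nat)).
  move: eq_val; rewrite eqN => /mulIf.
  rewrite invr_eq0 pnatr_eq0 -lt0n N_gt0 => /(_ isT) eq_sg.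
  apply: (@signr_inj rat); by rewrite !signr_odd.
apply/ffunP => i; rewrite -!count_indexE.
suff -> : count_index c = count_index c' by [].
apply/eqP; apply: contraT => ncc'.
have /forall_inP/(_ _ (count_index_Mset c))/forall_inP/(_ _ (count_index_Mset c')) := sep.
by rewrite ncc' /= -/(N c) -/(N c') eqN eqs !eqxx.
Qed.

End Counting.

(** * Labellings that induce the partitions of the theorem *)

Section Blocks.
Variables (t : nat) (K : finType) (blk : K -> 'I_t) (T : K -> finPzRingType).
Local Notation R := (prodR T).
Implicit Types a b : R.

Definition wtv a := blk_count blk (fun k => a k != 0).
Definition nradv a := blk_count blk (fun k => a k \notin jrad (T k)).
(** [None] labels the single block outside the socle. *)
Definition Hprime_label a : option {ffun 'I_t -> nat} :=
  if a \in soc R then Some (wtv a) else None.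
(** The flag separates [0] from the other radical elements, whose count vector is also zero. *)
Definition Hprime_dual_label a := (a == 0, nradv a).

Lemma nradv_eq0 a : (nradv a == [ffun=> 0%N]) = (a \in jrad R).
Proof.
rewrite jrad_prod; apply/eqP/forallP => [a0 k|aJ].
  have := blk_count_gt0 blk (fun k => a k \notin jrad (T k)) (blk k).
  rewrite -/(nradv a) a0 ffunE ltnn => /esym/negbT; rewrite negb_exists.
  by move/forallP/(_ k); rewrite eqxx /= negbK.
apply/ffunP => i; rewrite [RHS]ffunE; apply/eqP; rewrite -leqn0 leqNgt blk_count_gt0.
by apply/existsPn => k; rewrite aJ andbF.
Qed.

Lemma Hprime_partition : Hprime blk T = partition_of Hprime_label.
Proof.
apply: partition_of_blocks => [B x y|x].
  case/setU1P => [->|/imsetP[m _ ->]].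
    rewrite !inE /Hprime_label => /negPf->.
    by case: ifP.
  rewrite !inE /Hprime_label => /andP[-> /forallP xm].
  case: (y \in soc R) => //=; rewrite (inj_eq Some_inj).
  apply/forallP/eqP => [ym|yx i].
    by apply/ffunP => i; rewrite !ffunE; exact: etrans (eqP (ym i)) (esym (eqP (xm i))).
  by rewrite -(eqP (xm i)) /wt; have /ffunP/(_ i) := yx; rewrite !ffunE => ->.
have [xS|xS] := boolP (x \in soc R).
  exists (Pm blk T (count_index blk (fun k => x k != 0))).
    by rewrite inE; apply/orP; right; apply/imset_f/count_index_Mset.
  by rewrite inE xS; apply/forallP => i; rewrite count_indexE ffunE.
by exists (~: soc R); rewrite !inE ?eqxx.
Qed.

Lemma Hprime_dual_partition : Hprime_dual blk T = partition_of Hprime_dual_label.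
Proof.
have J0 : 0 \in jrad R by rewrite lideal0 ?jrad_lideal.
apply: partition_of_blocks => [B x y|x].
  case/setUP => [/set2P[]->|/imsetP[m _ ->]].
  - rewrite !inE /Hprime_dual_label xpair_eqE => /andP[/negPf-> xJ].
    have /eqP -> : nradv x == [ffun=> 0%N] by rewrite nradv_eq0.
    by rewrite nradv_eq0 eqbF_neg.
  - rewrite !inE /Hprime_dual_label => /eqP->; rewrite xpair_eqE eqxx.
    have /eqP-> : nradv 0 == [ffun=> 0%N] by rewrite nradv_eq0.
    by rewrite nradv_eq0 eqb_id; case: eqP => // ->.
  - rewrite !inE /Hprime_dual_label xpair_eqE => /andP[xJ /forallP xm].
    have n0 z : z \notin jrad R -> (z == 0) = false.
      by apply: contraNF => /eqP->.
    rewrite (n0 x) //; have [yJ|yJ] := boolP (y \in jrad R) => /=.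
      have /eqP-> : nradv y == [ffun=> 0%N] by rewrite nradv_eq0.
      by rewrite [_ == nradv x]eq_sym nradv_eq0 (negPf xJ) andbF.
    rewrite (n0 y) //=.
    apply/forallP/eqP => [ym|yx i].
      by apply/ffunP => i; rewrite !ffunE; exact: etrans (eqP (ym i)) (esym (eqP (xm i))).
    by rewrite -(eqP (xm i)); have /ffunP/(_ i) := yx; rewrite !ffunE => ->.
have [xJ|xJ] := boolP (x \in jrad R).
  have [->|x0] := eqVneq x 0.
    by exists [set 0]; rewrite ?inE ?eqxx ?orbT.
  by exists (jrad R :\ 0); rewrite ?inE ?eqxx ?x0.
exists (Qm blk T (count_index blk (fun k => x k \notin jrad (T k)))).
  rewrite inE; apply/orP; right; apply/imset_f; rewrite inE count_index_Mset /=.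
  move: xJ; rewrite jrad_prod negb_forall => /existsP[k xk].
  apply/existsP; exists (blk k); rewrite count_indexE -lt0n blk_count_gt0.
  by apply/existsP; exists k; rewrite eqxx.
by rewrite !inE xJ; apply/forallP => i; rewrite count_indexE ffunE.
Qed.

Lemma hamming_prod_partition : hamming_prod blk T = partition_of wtv.
Proof.
apply: eq_imset => x; apply/setP => y; rewrite !inE.
apply/forallP/eqP => [yx|yx i]; last by have /ffunP/(_ i) := yx; rewrite !ffunE => /eqP.
by apply/ffunP => i; rewrite !ffunE; apply/eqP/yx.
Qed.

Variable q : 'I_t -> nat.
Hypothesis locT : forall k, is_local (T k).
Hypothesis resT : forall k, #|T k| = (q (blk k) * #|jrad (T k)|)%N.
Hypothesis socT : forall k, #|soc (T k)| = q (blk k).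

Lemma partition_of_hom_weight w : separating blk q -> is_norm_hom_weight w ->
  partition_of w = partition_of Hprime_label.
Proof.
move=> sep hw; pose cw a := prod_coweight (fun k => q (blk k)) a.
have wE : w =1 (fun a => 1 - cw a).
  exact: norm_hom_weight_unique hw (prod_norm_hom_weight locT resT socT).
have q1 k : (1 < q (blk k))%N := local_q_gt1 (locT k) (resT k).
pose v a : rat := \prod_(k | a k != 0) - ((q (blk k))%:R - 1)^-1.
have cwS a : a \in soc R -> cw a = v a.
  rewrite soc_prod // => /forallP aS; rewrite /cw /v [RHS]big_mkcond.
  by apply: eq_bigr => k _; rewrite /soc_coweight aS; case: eqP.
(* Nonvanishing keeps the coweights on the socle apart from [0], the common coweight off the
   socle. *)
have v0 a : v a != 0.
  apply/prodf_neq0 => k _; rewrite oppr_eq0 invr_eq0 subr_eq0 pnatr_eq1.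
  by rewrite neq_ltn q1 orbT.
apply: eq_partition_of => x y; rewrite !wE.
have -> : (1 - cw y == 1 - cw x) = (cw y == cw x).
  by rewrite (inj_eq (addrI 1)) eqr_opp.
rewrite /Hprime_label.
have [yS|yS] := boolP (y \in soc R); have [xS|xS] := boolP (x \in soc R);
  rewrite ?(cwS _ xS) ?(cwS _ yS) /cw ?(prod_coweight_notin_soc _ _ xS) ?(prod_coweight_notin_soc _ _ yS) //.
- rewrite (inj_eq Some_inj); apply/eqP/eqP => [|yx].
    exact: (separating_blk_count sep).
  rewrite /v (prod_blk_count blk (fun i => - ((q i)%:R - 1)^-1)).
  rewrite -/(wtv y) yx /wtv -prod_blk_count //.
- by rewrite (negPf (v0 y)).
- by rewrite eq_sym (negPf (v0 x)).
Qed.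

End Blocks.

(** * Additive characters and orthogonality sums *)

Section Characters.
Variable R : finPzRingType.

(** If [chi v] differs from [1] for some [v] in [U], translation by [v] shows that the sum is
    unchanged when multiplied by [chi v], so it is zero. *)
Lemma sum_add_char (chi : R -> algC) (U : {set R}) : add_char chi -> 0 \in U ->
    (forall x y, x \in U -> y \in U -> x - y \in U) ->
  \sum_(u in U) chi u = if [forall u in U, chi u == 1] then #|U|%:R else 0.
Proof.
move=> [chi0 chiD] U0 UB; case: ifP => [/forall_inP chi1|/negbT].
  by rewrite (eq_bigr (fun=> 1)) ?sumr_const // => u /chi1/eqP.
rewrite negb_forall => /existsP[v]; rewrite negb_imply => /andP[vU chiv].
apply/eqP; have : (chi v - 1) * \sum_(u in U) chi u == 0.
  rewrite mulrBl mul1r subr_eq0 mulr_sumr; apply/eqP.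
  rewrite [RHS](reindex_inj (addrI v)) /=; apply: eq_big => [u|u _]; last by rewrite chiD.
  apply/idP/idP => [uU|vuU]; last by rewrite -[u](addKr v) addrC UB.
  by rewrite -[u]opprK UB // -sub0r UB.
by rewrite mulf_eq0 subr_eq0 (negPf chiv).
Qed.

Lemma sum_add_char_setT (chi : R -> algC) : add_char chi ->
  \sum_u chi u = if [forall u, chi u == 1] then #|R|%:R else 0.
Proof.
move=> chiA; have <- : [forall u in [set: R], chi u == 1] = [forall u, chi u == 1].
  by apply: eq_forallb => u; rewrite inE.
rewrite -cardsT -sum_add_char ?inE // => [|x y _ _]; last by rewrite inE.
by apply: eq_bigl => u; rewrite inE.
Qed.

Variable chi : R -> algC.

Definition nondegenerate_char : Prop :=
  [/\ add_char chi, (forall r, (forall x, chi (x * r) = 1) -> r = 0) &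
      (forall r, (forall x, chi (r * x) = 1) -> r = 0)].

Lemma add_char_mull a : add_char chi -> add_char (fun x => chi (a * x)).
Proof. by move=> [chi0 chiD]; split=> [|x y]; rewrite ?mulr0 ?mulrDr. Qed.

Lemma add_char_mulr a : add_char chi -> add_char (fun x => chi (x * a)).
Proof. by move=> [chi0 chiD]; split=> [|x y]; rewrite ?mul0r ?mulrDl. Qed.

(* Summing [chi (x * r)] over all pairs in both orders shows that the left
   kernel of the pairing has as many elements as the right one. *)
Lemma generating_char_nondegenerate : generating_char chi -> nondegenerate_char.
Proof.
move=> [chiA gen].
have inj r : (forall x, chi (x * r) = 1) -> r = 0.
  have [chi0 _] := chiA.
  have triv : add_char (fun _ : R => 1 : algC) by split=> // *; rewrite mulr1.
  have [s [_ uniq_s]] := gen _ triv => r1.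
  rewrite -(uniq_s r) => [|x]; last by rewrite r1.
  by rewrite -(uniq_s 0) // => x; rewrite mulr0.
split=> // r r1; apply/eqP.
pose L := [set x | [forall y, chi (x * y) == 1]].
have lhs : \sum_x \sum_y chi (x * y) = (#|L| * #|R|)%:R.
  rewrite natrM mulr_natl -sumr_const [RHS]big_mkcond; apply: eq_bigr => x _.
  by rewrite (sum_add_char_setT (add_char_mull x chiA)) inE.
have rhs : \sum_x \sum_y chi (x * y) = #|R|%:R.
  rewrite exchange_big (bigD1 0) //= [X in _ + X]big1 ?addr0 => [|y y0].
    by under eq_bigr do rewrite mulr0 chiA.1; rewrite sumr_const.
  rewrite (sum_add_char_setT (add_char_mulr y chiA)) ifF //.
  apply: contraNF y0 => /forallP y1.
  by apply/eqP/inj => x; apply/eqP/y1.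
have R_gt0 : (0 < #|R|)%N by apply/card_gt0P; exists 0.
have /eqP := etrans (esym lhs) rhs; rewrite eqr_nat -[X in _ == X]mul1n eqn_pmul2r //.
case/cards1P => z defL.
have : r \in L by rewrite inE; apply/forallP => x; rewrite r1.
have : 0 \in L by rewrite inE; apply/forallP => x; rewrite mul0r chiA.1.
by rewrite defL !inE => /eqP-> /eqP->.
Qed.

Hypothesis chiN : nondegenerate_char.

Lemma sum_char_setT_mull a :
  \sum_x chi (a * x) = if a == 0 then #|R|%:R else 0.
Proof.
have [chiA injl injr] := chiN.
rewrite (sum_add_char_setT (add_char_mull a chiA)).
suff -> : [forall u, chi (a * u) == 1] = (a == 0) by [].
apply/forallP/eqP => [a1|-> x]; last by rewrite mul0r chiA.1.
by apply: injr => x; apply/eqP/a1.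
Qed.

Lemma sum_char_setT_mulr a :
  \sum_x chi (x * a) = if a == 0 then #|R|%:R else 0.
Proof.
have [chiA injl injr] := chiN.
rewrite (sum_add_char_setT (add_char_mulr a chiA)).
suff -> : [forall u, chi (u * a) == 1] = (a == 0) by [].
apply/forallP/eqP => [a1|-> x]; last by rewrite mulr0 chiA.1.
by apply: injl => x; apply/eqP/a1.
Qed.

(** If the character is trivial on [I a], then [chi (r * (x * a)) = 1] for [x] in [I] and every [r],
    and nondegeneracy gives [x * a = 0]. *)
Lemma sum_char_lideal_mulr (I : {set R}) a : is_lideal I ->
  \sum_(x in I) chi (x * a) = if [forall x in I, x * a == 0] then #|I|%:R else 0.
Proof.
have [chiA injl injr] := chiN; case/is_lidealP=> I0 IB IM.
rewrite (sum_add_char (add_char_mulr a chiA)) //.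
suff -> : [forall u in I, chi (u * a) == 1] = [forall x in I, x * a == 0] by [].
apply/forall_inP/forall_inP => [a1 x xI|a0 x xI]; last by rewrite (eqP (a0 x xI)) chiA.1.
by apply/eqP/injl => r; rewrite mulrA; apply/eqP/a1/IM.
Qed.

(** The mirror argument multiplies on the right, which stays inside the left socle because the ring
    is local. *)
Lemma sum_char_soc_mull a : is_local R ->
  \sum_(x in soc R) chi (a * x) = if [forall x in soc R, a * x == 0] then #|soc R|%:R else 0.
Proof.
move=> locR; have [chiA injl injr] := chiN; case/is_lidealP: (soc_lideal R) => I0 IB IM.
rewrite (sum_add_char (add_char_mull a chiA)) //.
suff -> : [forall u in soc R, chi (a * u) == 1] = [forall x in soc R, a * x == 0] by [].
apply/forall_inP/forall_inP => [a1 x xI|a0 x xI]; last by rewrite (eqP (a0 x xI)) chiA.1.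
by apply/eqP/injr => r; rewrite -mulrA; apply/eqP/a1; rewrite local_soc_mulr.
Qed.

End Characters.

(** * Dual partitions in terms of labellings *)

Section DualPartition.
Variable R : finPzRingType.

(** The pairing [beta a b] stands for [chi (a * b)] or [chi (b * a)], so that right and left duals
    are treated together. *)
Lemma dual_partition_of (V V' : eqType) (f : R -> V) (g : R -> V') (beta : R -> R -> algC) :
    (forall a a', reflect (forall x, \sum_(b | f b == f x) beta a' b =
                                     \sum_(b | f b == f x) beta a b) (g a' == g a)) ->
  [set [set a' | [forall B in partition_of f,
     \sum_(b in B) beta a' b == \sum_(b in B) beta a b]] | a : R] = partition_of g.
Proof.
move=> gP; apply: eq_imset => a; apply/setP => a'; rewrite !inE.
have sumE z x : \sum_(b in [set y | f y == f x]) beta z b = \sum_(b | f b == f x) beta z b.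
  by apply: eq_bigl => b; rewrite inE.
apply/forall_inP/(gP a a') => [eqB x|eqB B /imsetP[x _ ->]]; last by rewrite !sumE eqB.
by rewrite -!sumE; apply/eqP/eqB/imset_f.
Qed.

(** Equal block sums stay equal under weights constant on blocks. Indicator weights then select or
    merge blocks, and a constant weight gives the total. *)
Lemma eq_weighted_block_sums (V : eqType) (f : R -> V) (F : V -> algC) (h h' : R -> algC) :
    (forall x, \sum_(b | f b == f x) h b = \sum_(b | f b == f x) h' b) ->
  \sum_b F (f b) * h b = \sum_b F (f b) * h' b.
Proof.
move=> hh'; pose p x := [set y | f y == f x].
have fibE x b : (p b == p x) = (f b == f x).
  apply/eqP/eqP => [pbx|e]; last by rewrite /p e.
  have : b \in p b by rewrite inE.
  by rewrite pbx inE => /eqP.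
have sumE k : \sum_b F (f b) * k b =
    \sum_(B in p @: setT) \sum_(b in setT | p b == B) F (f b) * k b.
  by rewrite -partition_big_imset; apply: eq_bigl => b; rewrite inE.
rewrite !sumE; apply: eq_bigr => _ /imsetP[x _ ->].
have e k : \sum_(b in setT | p b == p x) F (f b) * k b = F (f x) * \sum_(b | f b == f x) k b.
  rewrite mulr_sumr; apply: eq_big => [b|b]; first by rewrite inE fibE.
  by rewrite inE fibE => /eqP->.
by rewrite !e hh'.
Qed.

End DualPartition.

(** Distributivity over dependent functions, used to split an enumerator into one factor per
    component. Passing to [fprod] gives all summands a common tagged type. *)
Lemma sum_prodR (K : finType) (T : K -> finPzRingType) (C : comPzSemiRingType)
    (phi : forall k, T k -> C) :
  \sum_(b : prodR T) \prod_k phi k (b k) = \prod_k \sum_(x : T k) phi k x.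
Proof.
under [RHS]eq_bigr do rewrite (big_tag phi).
rewrite bigA_distr_big_dep.
pose phi' k := [ffun x : T k => phi k x].
transitivity (\sum_(b : fprod T) \prod_k phi' k (b k)).
  rewrite (reindex (@dffun_of_fprod K T)); last exact/onW_bij/dffun_of_fprod_bij.
  by apply: eq_bigr => b _; apply: eq_bigr => k _; rewrite !ffunE.
rewrite (@big_fprod C 0 1 *%R +%R K T phi'); apply: eq_bigr => g _.
by apply: eq_bigr => k _; rewrite /untag; case: eqP => // e; rewrite ffunE.
Qed.

(** * Krawtchouk generating polynomials in one variable per group *)

Section Krawtchouk.
Variables (t : nat) (K : finType) (blk : K -> 'I_t) (q : 'I_t -> nat).

Lemma blk_count_predC (c : pred K) i :
  (blk_count blk c i + blk_count blk (predC c) i = nblk blk i)%N.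
Proof.
rewrite !ffunE /nblk -(cardsID [set k | c k] [set k | blk k == i]).
by congr (_ + _)%N; apply: eq_card => k; rewrite !inE // andbC.
Qed.

Lemma eq_blk_countC (c c' : pred K) i :
  (blk_count blk (predC c) i == blk_count blk (predC c') i) =
  (blk_count blk c i == blk_count blk c' i).
Proof.
have e := blk_count_predC c i; have e' := blk_count_predC c' i.
apply/eqP/eqP => h; last by apply: (@addnI (blk_count blk c i)); rewrite e h e'.
by apply: (@addIn (blk_count blk (predC c) i)); rewrite e h e'.
Qed.

Definition monom (c : pred K) : {mpoly algC[t]} := \prod_(k | c k) 'X_(blk k).

Lemma monomE c : monom c = 'X_[ [multinom blk_count blk c i | i < t] ].
Proof.
rewrite /monom (prod_blk_count blk (fun i => 'X_i)) mpolyXE_id.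
by apply: eq_bigr => i _; rewrite mnmE.
Qed.

(** Distinct count vectors give distinct monomials, so coefficients of an enumerator are its sums
    over fixed count vectors. *)
Lemma mcoeff_sum_monom (I : finType) (P : pred I) (F : I -> algC) (c : I -> pred K)
    (m : 'X_{1.. t}) :
  (\sum_(b | P b) F b *: monom (c b))@_m =
  \sum_(b | P b && (blk_count blk (c b) == [ffun i => m i])) F b.
Proof.
rewrite raddf_sum /= big_mkcondr; apply: eq_bigr => b _.
rewrite mcoeffZ monomE mcoeffX.
have -> : ([multinom blk_count blk (c b) i | i < t] == m) =
          (blk_count blk (c b) == [ffun i => m i]).
  apply/eqP/eqP => [<-|e]; first by apply/ffunP => i; rewrite [RHS]ffunE mnmE.
  by apply/mnmP => i; rewrite mnmE e [LHS]ffunE.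
by case: eqP; rewrite ?mulr1 ?mulr0.
Qed.

Lemma meval1_monom c : (monom c).@[fun=> 1] = 1.
Proof. by rewrite monomE mevalX big1 // => i _; rewrite expr1n. Qed.

(** Generating function of products of Krawtchouk polynomials: group [i] contributes [(1 -
    X_i)^(c_i) (1 + (q_i - 1) X_i)^(n_i - c_i)]. *)
Definition kraw (c : pred K) : {mpoly algC[t]} :=
  \prod_k (if c k then 1 - 'X_(blk k) else 1 + ((q (blk k))%:R - 1) *: 'X_(blk k)).

Lemma meval_kraw c v : (kraw c).@[v] =
  \prod_k (if c k then 1 - v (blk k) else 1 + ((q (blk k))%:R - 1) * v (blk k)).
Proof.
rewrite rmorph_prod; apply: eq_bigr => k _ /=.
by case: ifP => _; rewrite ?mevalB ?mevalD ?mevalZ meval1 mevalXU.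
Qed.

(** The constant term is [1]. This later tells socle elements from the others, whose enumerator
    vanishes. *)
Lemma kraw_neq0 c : kraw c != 0.
Proof.
apply/eqP => /(congr1 (fun p => p.@[fun=> 0])); rewrite meval_kraw meval0 big1 => [/eqP|k _].
  by rewrite oner_eq0.
by rewrite mulr0 subr0 addr0 if_same.
Qed.

Lemma krawE c : kraw c =
  \prod_i (1 - 'X_i) ^+ blk_count blk c i *
  \prod_i (1 + ((q i)%:R - 1) *: 'X_i) ^+ blk_count blk (predC c) i.
Proof.
rewrite /kraw (bigID c) /= -!prod_blk_count; congr (_ * _); apply: eq_bigr => k.
  by move=> ->.
by move=> /negPf->.
Qed.

(* At [X_i = 2] and [X_j = 0] for [j <> i] the polynomial takes the value
   [(-1) ^ c * (2 q - 1) ^ (n - c)], whose absolute value determines [c]. *)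
Lemma kraw_inj c c' : (forall k, (1 < q (blk k))%N) ->
  kraw c = kraw c' <-> blk_count blk c = blk_count blk c'.
Proof.
move=> q1; split=> [eqk|eqc]; last first.
  rewrite !krawE eqc; congr (_ * _); apply: eq_bigr => i _; congr (_ ^+ _).
  by apply/eqP; rewrite eq_blk_countC eqc.
apply/ffunP => i; apply/eqP; rewrite -eq_blk_countC.
(* A value [q i <= 1] occurs only for an empty group, where all counts are zero. *)
have [qi|qi] := leqP (q i) 1.
  suff n0 d : blk_count blk d i = 0%N by rewrite !n0.
  apply/eqP; rewrite -leqn0 leqNgt blk_count_gt0; apply/existsPn => k.
  by apply/negP => /andP[/eqP bk]; move: (q1 k); rewrite bk ltnNge qi.
have q2 : (0 < 2 * q i)%N by rewrite muln_gt0 /= ltnW.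
pose v j : algC := if j == i then 2 else 0.
have val d : `|(kraw d).@[v]| = ((2 * q i - 1) ^ blk_count blk (predC d) i)%:R.
  rewrite krawE mevalM normrM !rmorph_prod !normr_prod big1 ?mul1r => [|j _]; last first.
    rewrite rmorphXn /= mevalB meval1 mevalXU normrX /v; case: eqP => _.
      by rewrite opprD addrA subrr sub0r normrN1 expr1n.
    by rewrite subr0 normr1 expr1n.
  rewrite (bigD1 i) //= [X in _ * X]big1 ?mulr1 => [|j ji]; last first.
    rewrite rmorphXn /= mevalD mevalZ meval1 mevalXU /v (negPf ji).
    by rewrite mulr0 addr0 expr1n normr1.
  rewrite rmorphXn /= mevalD mevalZ meval1 mevalXU /v eqxx natrX normrX.
  congr (_ ^+ _); rewrite natrB // natrM.
  have -> : 1 + ((q i)%:R - 1) * 2 = 2 * (q i)%:R - 1 :> algC.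
    rewrite mulrBl mul1r mulrC addrCA; congr (_ + _).
    by rewrite opprD addrA subrr sub0r.
  by rewrite ger0_norm // subr_ge0 -natrM (ler_nat _ 1).
have := congr1 (fun p => `|p.@[v]|) eqk; rewrite /= !val => /eqP.
rewrite eqr_nat eqn_exp2l //.
by case: (q i) qi => [|[|n]] // _; rewrite mulnSr addnS subn1 /= !mulnS.
Qed.

End Krawtchouk.

(** * Labels and block sums for a pairing multiplicative over the components *)

Section Duals.
Variables (t : nat) (K : finType) (blk : K -> 'I_t) (q : 'I_t -> nat).
Variable T : K -> finPzRingType.
Local Notation R := (prodR T).
Hypothesis locT : forall k, is_local (T k).
Hypothesis resT : forall k, #|T k| = (q (blk k) * #|jrad (T k)|)%N.

Variables (beta : R -> R -> algC) (betak : forall k, T k -> T k -> algC).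
Hypothesis betaE : forall a b, beta a b = \prod_k betak (a k) (b k).
Hypothesis betak0 : forall k (x : T k), betak x 0 = 1.

Let q1 k : (1 < q (blk k))%N := local_q_gt1 (locT k) (resT k).

Lemma beta0 a : beta a 0 = 1.
Proof. by rewrite betaE big1 // => k _; rewrite prod0E betak0. Qed.

Lemma sum_soc_kraw a :
    (forall k (x : T k), \sum_(s in soc (T k)) betak x s =
       if x \in jrad (T k) then (q (blk k))%:R else 0) ->
  \sum_(b in soc R) beta a b *: monom blk (fun k => b k != 0) =
  kraw blk q (fun k => a k \notin jrad (T k)).
Proof.
move=> sum_soc.
pose phi k (x : T k) : {mpoly algC[t]} :=
  if x \in soc (T k) then betak (a k) x *: (if x != 0 then 'X_(blk k) else 1) else 0.
rewrite big_mkcond; transitivity (\sum_(b : R) \prod_k phi k (b k)).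
  apply: eq_bigr => b _; rewrite soc_prod //.
  case: ifPn => [/forallP bS|]; last first.
    rewrite negb_forall => /existsP[k bk]; rewrite (bigD1 k) //= {1}/phi (negPf bk).
    by rewrite mul0r.
  rewrite betaE /monom [X in _ *: X]big_mkcond -scaler_prod.
  by apply: eq_bigr => k _; rewrite /phi bS.
rewrite sum_prodR; apply: eq_bigr => k _.
rewrite -big_mkcond (bigD1 0) ?lideal0 ?soc_lideal //= eqxx betak0 scale1r.
rewrite (eq_bigr (fun x => betak (a k) x *: 'X_(blk k))) => [|x /andP[_ ->] //].
rewrite -scaler_suml.
(* Without the term at zero, the sum is [q - 1] for [a k] in the radical and [-1] otherwise. *)
have -> : \sum_(x in soc (T k) | x != 0) betak (a k) x =
    (if a k \in jrad (T k) then (q (blk k))%:R else 0) - 1.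
  rewrite -sum_soc [in RHS](bigD1 0) ?lideal0 ?soc_lideal //= betak0.
  by rewrite addrC addrK.
by case: (a k \in jrad (T k)); rewrite //= sub0r scaleN1r.
Qed.

(** In each component the radical contributes to the constant term and its complement to [X]. Off
    the socle both sums vanish; at zero they give [|J| (1 + (q - 1) X)], and at other socle elements
    [|J| (1 - X)], with [J] the local radical. *)
Lemma sum_jrad_kraw a :
    (forall k (x : T k), \sum_(y in jrad (T k)) betak x y =
       if x \in soc (T k) then #|jrad (T k)|%:R else 0) ->
    (forall k (x : T k), \sum_y betak x y = if x == 0 then #|T k|%:R else 0) ->
  \sum_b beta a b *: monom blk (fun k => b k \notin jrad (T k)) =
  if a \in soc R then (\prod_k #|jrad (T k)|%:R) *: kraw blk q (fun k => a k != 0) else 0.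
Proof.
move=> sum_jrad sum_all.
pose phi k (x : T k) : {mpoly algC[t]} :=
  betak (a k) x *: (if x \notin jrad (T k) then 'X_(blk k) else 1).
transitivity (\sum_(b : R) \prod_k phi k (b k)).
  apply: eq_bigr => b _.
  by rewrite betaE /monom [X in _ *: X]big_mkcond -scaler_prod.
rewrite sum_prodR.
have phiE k : \sum_x phi k x = if a k \in soc (T k) then
    #|jrad (T k)|%:R *: (if a k != 0 then 1 - 'X_(blk k)
                         else 1 + ((q (blk k))%:R - 1) *: 'X_(blk k)) else 0.
  rewrite (bigID (mem (jrad (T k)))) /= /phi.
  rewrite (eq_bigr (fun x => betak (a k) x *: 1)) => [|x -> //].
  rewrite [X in _ + X](eq_bigr (fun x => betak (a k) x *: 'X_(blk k))) => [|x -> //].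
  rewrite -!scaler_suml.
  have -> : \sum_(x | x \notin jrad (T k)) betak (a k) x =
      (if a k == 0 then #|T k|%:R else 0) - (if a k \in soc (T k) then #|jrad (T k)|%:R else 0).
    by rewrite -sum_all -sum_jrad [in RHS](bigID (mem (jrad (T k)))) /= addrC addrK.
  rewrite sum_jrad; have [->|ak0] /= := eqVneq (a k) 0.
    rewrite lideal0 ?soc_lideal // resT natrM scalerDr scalerA mulrBr mulr1.
    by rewrite [_%:R * _%:R]mulrC.
  case: ifP => _; last by rewrite subr0 !scale0r addr0.
  by rewrite sub0r scalerBr scaleNr.
rewrite (eq_bigr _ (fun k _ => phiE k)) soc_prod //.
case: ifPn => [/forallP aS|].
  by rewrite -scaler_prod; apply: eq_bigr => k _; rewrite aS.
by rewrite negb_forall => /existsP[k ak]; rewrite (bigD1 k) //= (negPf ak) mul0r.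
Qed.

(** Block sums inside the socle are coefficients of [kraw], so the label determines them all.
    Conversely, the total sum recovers the zero flag, and the coefficients recover the count vector
    through [kraw_inj]. *)
Lemma Hprime_dual_labelP (a a' : R) :
    (forall k (x : T k), \sum_(s in soc (T k)) betak x s =
       if x \in jrad (T k) then (q (blk k))%:R else 0) ->
    (forall c : R, \sum_b beta c b = if c == 0 then #|R|%:R else 0) ->
  reflect (forall x : R, \sum_(b | Hprime_label blk b == Hprime_label blk x) beta a' b =
                     \sum_(b | Hprime_label blk b == Hprime_label blk x) beta a b)
          (Hprime_dual_label blk a' == Hprime_dual_label blk a).
Proof.
move=> sum_soc sum_all.
pose p c := kraw blk q (fun k => c k \notin jrad (T k)).
have pE c : \sum_(b in soc R) beta c b *: monom blk (fun k => b k != 0) = p c.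
  exact: sum_soc_kraw.
apply: (iffP eqP) => [[a0 /(kraw_inj _ _ q1) ap] x|eqx].
  rewrite /Hprime_label; case: (x \in soc R).
    pose m : 'X_{1.. t} := [multinom wtv blk x i | i < t].
    have sumE c : \sum_(b | (if b \in soc R then Some (wtv blk b) else None) == Some (wtv blk x))
        beta c b = (p c)@_m.
      rewrite -pE mcoeff_sum_monom; apply: eq_bigl => b.
      have -> : [ffun i => m i] = wtv blk x by apply/ffunP => i; rewrite [LHS]ffunE mnmE.
      by case: (b \in soc R).
    by rewrite !sumE /p ap.
  (* The block outside the socle is the whole ring minus the socle, and the sum over the socle is
     the enumerator evaluated at all ones. *)
  have sumE c : \sum_(b | (if b \in soc R then Some (wtv blk b) else None) == None) beta c b =
      (if c == 0 then #|R|%:R else 0) - (p c).@[fun=> 1].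
    have -> : (p c).@[fun=> 1] = \sum_(b in soc R) beta c b.
      rewrite -pE rmorph_sum; apply: eq_bigr => b _ /=.
      by rewrite mevalZ meval1_monom mulr1.
    rewrite -sum_all [in RHS](bigID (mem (soc R))) /=.
    by rewrite addrC addrK; apply: eq_bigl => b; case: (b \in soc R).
  by rewrite !sumE /p ap a0.
have eqF F := eq_weighted_block_sums F eqx.
rewrite /Hprime_dual_label; congr (_, _).
  have := eqF (fun=> 1); under eq_bigr do rewrite mul1r.
  under [RHS]eq_bigr do rewrite mul1r.
  have R0 : #|R|%:R != 0 :> algC by rewrite pnatr_eq0 -lt0n; apply/card_gt0P; exists 0.
  rewrite !sum_all; case: (a' == 0); case: (a == 0) => // /eqP; first by rewrite (negPf R0).
  by rewrite eq_sym (negPf R0).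
apply/(kraw_inj _ _ q1); rewrite -/(p a') -/(p a) -!pE; apply/mpolyP => m.
rewrite !mcoeff_sum_monom.
pose F (l : option {ffun 'I_t -> nat}) : algC := (l == Some [ffun i => m i])%:R.
have FE c : \sum_(b in soc R | blk_count blk (fun k => b k != 0) == [ffun i => m i]) beta c b =
    \sum_b F (Hprime_label blk b) * beta c b.
  rewrite big_mkcond; apply: eq_bigr => b _; rewrite /F /Hprime_label /wtv.
  case: (b \in soc R) => /=; last by rewrite mul0r.
  by rewrite (inj_eq Some_inj); case: eqP; rewrite ?mul1r ?mul0r.
by rewrite !FE.
Qed.

Lemma Hprime_labelP (a a' : R) :
    (forall k (x : T k), \sum_(y in jrad (T k)) betak x y =
       if x \in soc (T k) then #|jrad (T k)|%:R else 0) ->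
    (forall k (x : T k), \sum_y betak x y = if x == 0 then #|T k|%:R else 0) ->
  reflect (forall x : R, \sum_(b | Hprime_dual_label blk b == Hprime_dual_label blk x) beta a' b =
                     \sum_(b | Hprime_dual_label blk b == Hprime_dual_label blk x) beta a b)
          (Hprime_label blk a' == Hprime_label blk a).
Proof.
move=> sum_jrad sum_all.
pose J : algC := \prod_k #|jrad (T k)|%:R.
have J0 : J != 0.
  apply/prodf_neq0 => k _; rewrite pnatr_eq0 -lt0n; apply/card_gt0P; exists 0.
  exact: lideal0 (jrad_lideal _).
pose p (c : R) := if c \in soc R then J *: kraw blk q (fun k => c k != 0) else 0.
have pE c : \sum_b beta c b *: monom blk (fun k => b k \notin jrad (T k)) = p c.
  exact: sum_jrad_kraw.
(* The enumerator vanishes exactly off the socle, and on the socle it determines the weight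
   vector. *)
have pP : p a' = p a <-> Hprime_label blk a' = Hprime_label blk a.
  rewrite /p /Hprime_label.
  case: (a' \in soc R); case: (a \in soc R) => //.
  - split=> [/(scalerI J0)/(kraw_inj _ _ q1)|[/(kraw_inj _ _ q1)->] //].
    by rewrite /wtv => ->.
  - split=> // /eqP; rewrite scaler_eq0 (negPf J0) (negPf (kraw_neq0 _ _ _)) //.
  - split=> // /esym/eqP; rewrite scaler_eq0 (negPf J0) (negPf (kraw_neq0 _ _ _)) //.
apply: (iffP eqP) => [/pP ap x|eqx].
  rewrite /Hprime_dual_label.
  under eq_bigl do rewrite xpair_eqE; under [RHS]eq_bigl do rewrite xpair_eqE.
  have [->|x0] := eqVneq x 0.
    have sumE c : \sum_(b | ((b == 0) == true) && (nradv blk b == nradv blk (0 : R))) beta c b = 1.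
      rewrite (big_pred1 0) ?beta0 // => b; rewrite eqb_id.
      by rewrite andb_idr // => /eqP->.
    by rewrite !sumE.
  pose m : 'X_{1.. t} := [multinom nradv blk x i | i < t].
  (* The coefficient also counts [b = 0] when [x] is in the radical; its term [1] is subtracted,
     since zero is a block of its own. *)
  have sumE c : \sum_(b | ((b == 0) == false) && (nradv blk b == nradv blk x)) beta c b =
      (p c)@_m - (if nradv blk (0 : R) == nradv blk x then 1 else 0).
    rewrite -pE mcoeff_sum_monom.
    have -> : [ffun i => m i] = nradv blk x by apply/ffunP => i; rewrite [LHS]ffunE mnmE.
    rewrite [in RHS](bigID (fun b => b == 0)) /=.
    rewrite [X in _ = X + _ - _](_ : _ = if nradv blk (0 : R) == nradv blk x then 1 else 0).
      by rewrite addrAC subrr add0r; apply: eq_bigl => b; rewrite eqbF_neg andbC.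
    case: ifP => n0x.
      rewrite (big_pred1 0) ?beta0 // => b; rewrite andb_idl // => /eqP->.
      by rewrite -/(nradv blk (0 : R)) n0x.
    rewrite big_pred0 // => b; apply/negP => /andP[nbx /eqP b0].
    by move: nbx; rewrite b0 -/(nradv blk (0 : R)) n0x.
  by rewrite !sumE ap.
apply/pP; rewrite -!pE; apply/mpolyP => m; rewrite !mcoeff_sum_monom /=.
(* This weight ignores the flag, which merges the block of zero with the rest of the radical. *)
pose F (l : bool * {ffun 'I_t -> nat}) : algC := (l.2 == [ffun i => m i])%:R.
have FE c : \sum_(b : R | blk_count blk (fun k => b k \notin jrad (T k)) == [ffun i => m i]) beta c b =
    \sum_b F (Hprime_dual_label blk b) * beta c b.
  rewrite big_mkcond; apply: eq_bigr => b _; rewrite /F /= /nradv.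
  by case: eqP; rewrite ?mul1r ?mul0r.
by rewrite !FE; apply: eq_weighted_block_sums.
Qed.

End Duals.

(** * Restriction of a character to the factors *)

Section CharacterComponents.
Variables (K : finType) (T : K -> finPzRingType) (chi : prodR T -> algC).

Lemma add_char_prod : add_char chi -> forall a, chi a = \prod_k chi (pinj (a k)).
Proof.
by move=> [chi0 chiD] a; rewrite -{1}[a]sum_pinj; apply: (big_morph chi).
Qed.

(** Multiplying an element supported on one factor by anything stays in that factor, so a kernel
    there is a kernel in the product. *)
Lemma nondegenerate_char_pinj k : nondegenerate_char chi ->
  nondegenerate_char (fun x : T k => chi (pinj x)).
Proof.
move=> [[chi0 chiD] injl injr]; split.
- by split=> [|x y]; rewrite ?pinj0 ?pinjD.
- move=> r r1; rewrite -(pinj_in r) (_ : pinj r = 0) ?prod0E //.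
  by apply: injl => a; rewrite mul_pinj r1.
- move=> r r1; rewrite -(pinj_in r) (_ : pinj r = 0) ?prod0E //.
  by apply: injr => a; rewrite pinj_mul r1.
Qed.

End CharacterComponents.

(** * The left and right duals of the socle partition *)

Section DualsOfHprime.
Variables (t : nat) (K : finType) (blk : K -> 'I_t) (T : K -> finPzRingType).
Variable q : 'I_t -> nat.
Local Notation R := (prodR T).
Hypothesis locT : forall k, is_local (T k).
Hypothesis resT : forall k, #|T k| = (q (blk k) * #|jrad (T k)|)%N.
Hypothesis socT : forall k, #|soc (T k)| = q (blk k).
Variable chi : R -> algC.
Hypothesis chiN : nondegenerate_char chi.

Let chik k (x : T k) := chi (pinj x).
Let chikN k : nondegenerate_char (@chik k) := nondegenerate_char_pinj k chiN.

Let chi_mulE (a b : R) : chi (a * b) = \prod_k chik (a k * b k).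
Proof.
have [chiA _ _] := chiN; rewrite (add_char_prod chiA).
by apply: eq_bigr => k _; rewrite prodME.
Qed.

Lemma rdual_Hprime_label :
  rdual chi (partition_of (@Hprime_label _ _ blk T)) = partition_of (@Hprime_dual_label _ _ blk T).
Proof.
apply: (dual_partition_of (beta := fun a b => chi (a * b))) => a a'.
apply: (Hprime_dual_labelP locT resT (beta := fun a b => chi (a * b)) (betak := fun k x y => chik (x * y))).
- exact: chi_mulE.
- by move=> k x; rewrite mulr0; case: (chikN k) => -[].
- move=> k x; rewrite (sum_char_soc_mull (chikN k)) // socT.
  by rewrite -(local_jrad_annr (locT k) (resT k)).
- exact: sum_char_setT_mull.
Qed.

Lemma ldual_Hprime_label :
  ldual chi (partition_of (@Hprime_label _ _ blk T)) = partition_of (@Hprime_dual_label _ _ blk T).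
Proof.
apply: (dual_partition_of (beta := fun a b => chi (b * a))) => a a'.
apply: (Hprime_dual_labelP locT resT (beta := fun a b => chi (b * a)) (betak := fun k x y => chik (y * x))).
- by move=> b c; rewrite chi_mulE.
- by move=> k x; rewrite mul0r; case: (chikN k) => -[].
- move=> k x; rewrite (sum_char_lideal_mulr (chikN k)) ?soc_lideal // socT.
  by rewrite -(local_jrad_annl (locT k) (resT k)).
- exact: sum_char_setT_mulr.
Qed.

(** Gives reflexivity when applied after [rdual_Hprime_label]. A sum over a local radical is nonzero
    exactly when the radical kills [x] from the left, that is, when [x] is in the left socle. *)
Lemma ldual_Hprime_dual_label :
  ldual chi (partition_of (@Hprime_dual_label _ _ blk T)) = partition_of (@Hprime_label _ _ blk T).
Proof.
apply: (dual_partition_of (beta := fun a b => chi (b * a))) => a a'.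
apply: (Hprime_labelP locT resT (beta := fun a b => chi (b * a)) (betak := fun k x y => chik (y * x))).
- by move=> b c; rewrite chi_mulE.
- by move=> k x; rewrite mul0r; case: (chikN k) => -[].
- by move=> k x; rewrite (sum_char_lideal_mulr (chikN k)) ?jrad_lideal // local_soc.
- by move=> k x; exact: sum_char_setT_mulr.
Qed.

End DualsOfHprime.

Theorem theorem4p4 (t : nat) (K : finType) (blk : K -> 'I_t)
    (T : K -> finPzRingType) (q : 'I_t -> nat)
    (Hloc : forall k, is_local (T k))
    (Hfrob : forall k, is_frobenius (T k))
    (Hres : forall k, #|T k| = (q (blk k) * #|jrad (T k)|)%N)
    (Hsoc : forall k, #|soc (T k)| = q (blk k))
    (Hdist : injective q)
    (Hsep : separating blk q)
    (w : prodR T -> rat) (Hw : is_norm_hom_weight w) :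
  partition_of w = Hprime blk T
  /\ (forall chi : prodR T -> algC, generating_char chi ->
        [/\ reflexive_part chi (partition_of w),
            ldual chi (partition_of w) = Hprime_dual blk T &
            rdual chi (partition_of w) = Hprime_dual blk T])
  /\ (soc (prodR T) = [set: prodR T] ->
        partition_of w = hamming_prod blk T
        /\ forall chi : prodR T -> algC, generating_char chi ->
             self_dual_part chi (partition_of w)).
Proof.
rewrite Hprime_partition Hprime_dual_partition hamming_prod_partition.
rewrite (partition_of_hom_weight Hloc Hres Hsoc Hsep Hw).
split=> //; split=> [chi /generating_char_nondegenerate chiN|socR].
  split; [|exact: ldual_Hprime_label|exact: rdual_Hprime_label].
  rewrite /reflexive_part (rdual_Hprime_label Hloc Hres Hsoc chiN).
  exact: ldual_Hprime_dual_label.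
(* If the socle is everything, it contains [1], which the radical must kill; hence each local
   radical is zero. *)
have jrad0 k (x : T k) : (x \in jrad (T k)) = (x == 0).
  apply/idP/eqP => [xJ|->]; last by rewrite lideal0 ?jrad_lideal.
  have S1 : (1 : prodR T) \in soc (prodR T) by rewrite socR inE.
  have := soc_jrad_ann S1 (pinj_jrad xJ).
  by rewrite mulr1 => x0; rewrite -(pinj_in x) x0 prod0E.
have labelE (x y : prodR T) : (Hprime_label blk y == Hprime_label blk x) =
    (wtv blk y == wtv blk x).
  by rewrite /Hprime_label socR !in_setT (inj_eq Some_inj).
split=> [|chi /generating_char_nondegenerate chiN]; first exact: eq_partition_of.
rewrite /self_dual_part (rdual_Hprime_label Hloc Hres Hsoc chiN).
apply: eq_partition_of => x y; rewrite labelE /Hprime_dual_label xpair_eqE.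
(* With zero radicals the counts outside the radical are the Hamming weights, and weight zero
   already determines the flag, so both labels have the same level sets. *)
have nradE z : nradv blk z = wtv blk (z : prodR T).
  by apply/ffunP => i; rewrite !ffunE; apply: eq_card => k; rewrite !inE jrad0.
have z0 (z : prodR T) : (z == 0) = (wtv blk z == [ffun=> 0%N]).
  rewrite -nradE nradv_eq0 jrad_prod; apply/eqP/forallP => [-> k|z0].
    by rewrite prod0E jrad0.
  by apply/ffunP => k; apply/eqP; rewrite prod0E -jrad0.
rewrite !nradE !z0 andb_idl // => /eqP->.
by rewrite eqxx.
Qed.
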